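(* Let $(X,\leq)$ be a partially ordered set and let $d$ be a metric on $X$ such that $(X,d)$ is a complete metric space. Let $F: X\times X\to X$ be a continuous mapping having the mixed monotone property on $X$. Assume that there exist $\alpha,\beta>0$ with $\alpha+\beta<1$ such that $$d(F(x,y),F(u,v))\leq \alpha\, M((x,y),(u,v))+\frac{\beta}{2}\,[d(x,u)+d(y,v)]$$ for all $(x,y),(u,v)\in X\times X$ with $x\geq u$ and $y\leq v$. Assume also that there exist $x_0,y_0\in X$ such that $$x_0\leq F(x_0,y_0)\quad\text{and}\quad y_0\geq F(y_0,x_0).$$ Then $F$ has a coupled fixed point $(x,y)\in X\times X$.
   Context: Let $(X,\leq)$ be a partially ordered set with a metric $d$, and let $F:X\times X\to X$. Mixed monotone property: $F$ has the mixed monotone property on $X$ if for any $x,y\in X$: for all $x_1,x_2\in X$, $x_1\leq x_2$ implies $F(x_1,y)\leq F(x_2,y)$; and for all $y_1,y_2\in X$, $y_1\leq y_2$ implies $F(x,y_1)\geq F(x,y_2)$. Coupled fixed point: $(x,y)\in X\times X$ is a coupled fixed point of $F$ if $F(x,y)=x$ and $F(y,x)=y$. The quantity $M$: for $(x,y),(u,v)\in X\times X$, $M((x,y),(u,v))$ denotes $$\min\left\{d(x,F(x,y))\,\frac{2+d(u,F(u,v))+d(v,F(v,u))}{2+d(x,u)+d(y,v)},\ d(u,F(u,v))\,\frac{2+d(x,F(x,y))+d(y,F(y,x))}{2+d(x,u)+d(y,v)}\right\}.$$ *)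

(* Defs.v *)
From HB Require Import structures.
From mathcomp Require Import all_boot all_order all_algebra.
From mathcomp Require Import all_classical all_reals all_analysis.

Set Implicit Arguments.
Unset Strict Implicit.
Unset Printing Implicit Defensive.

Import Order.TTheory GRing.Theory Num.Theory.

Local Open Scope ring_scope.

(* No compatibility between the order and the metric is required. [Complete]
   includes a base point, so X is nonempty here. *)
#[short(type="porderCompleteMetricType")]
HB.structure Definition POrderCompleteMetric
    (R : numDomainType) (disp : Order.disp_t) :=
  { X of Metric R X & Complete X & Order.POrder disp X }.

Definition mixed_monotone (disp : Order.disp_t) (X : porderType disp)
    (F : X * X -> X) : Prop :=
  forall x y : X,
    (forall x1 x2 : X, (x1 <= x2)%O -> (F (x1, y) <= F (x2, y))%O) /\
    (forall y1 y2 : X, (y1 <= y2)%O -> (F (x, y1) >= F (x, y2))%O).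

Definition coupled_fixed_point (X : Type) (F : X * X -> X) (p : X * X) : Prop :=
  F (p.1, p.2) = p.1 /\ F (p.2, p.1) = p.2.

Definition contraction_M (R : realType) (X : metricType R) (F : X * X -> X)
    (p q : X * X) : R :=
  let: (x, y) := p in
  let: (u, v) := q in
  Num.min
    (mdist x (F (x, y)) *
       ((2 + mdist u (F (u, v)) + mdist v (F (v, u))) /
        (2 + mdist x u + mdist y v)))
    (mdist u (F (u, v)) *
       ((2 + mdist x (F (x, y)) + mdist y (F (y, x))) /
        (2 + mdist x u + mdist y v))).

(* Main.v *)
Require Import Defs.
From HB Require Import structures.
From mathcomp Require Import all_boot all_order all_algebra.
From mathcomp Require Import all_classical all_reals all_analysis.
From mathcomp Require Import lra.

Set Implicit Arguments.
Unset Strict Implicit.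
Unset Printing Implicit Defensive.

Import Order.TTheory GRing.Theory Num.Theory.
Import numFieldNormedType.Exports.

Local Open Scope ring_scope.

(** A coupled fixed point of [F] is a fixed point of the map
    [coupled_map F : (x, y) |-> (F (x, y), F (y, x))], and it is obtained as the
    limit of the orbit of the starting pair under this map.

    Order the pairs by increasing first and decreasing second component. The
    mixed monotone property says exactly that [coupled_map F] preserves this
    order, so an orbit that starts with an increase keeps increasing. Hence any
    two consecutive pairs [p], [q] of the orbit are comparable and the
    contractive inequality applies to them.

    For consecutive pairs the rational factor in one of the two terms of the
    minimum [M] collapses to [1], because the distances from [p] to its
    image that occur in its numerator are those between [p] and [q] in
    its denominator.
    Hence [M] is at most [d (q.1, F q)], the very distance that the inequality
    bounds, so this term can be absorbed in the left-hand side: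
    [(1 - alpha) * d (q.1, F q) <= beta / 2 * displacement F p], and likewise
    for the second component. Adding the two inequalities, the total
    displacement shrinks at each step by the factor [beta / (1 - alpha)], which
    is less than [1] ([displacement_coupled_map]).

    Both components of the orbit therefore have geometrically bounded steps,
    hence are Cauchy ([cauchy_geometric_steps]) and converge; continuity of [F]
    turns the recurrence into the fixed point equations. *)

(** The distance from the [N]-th term to any later one is at most the tail
    [C * k ^+ N / (1 - k)] of a geometric series, so a ball of any radius around
    a late enough term contains all the following ones. *)
Lemma cauchy_geometric_steps (R : realType) (T : metricType R) (u : nat -> T)
    (C k : R) : 0 <= C -> 0 <= k -> k < 1 ->
  (forall n, mdist (u n) (u n.+1) <= C * k ^+ n) ->
  cauchy (u @ \oo)%classic.
Proof.
move=> C0 k0 k1 uC.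
(* The term in [n + m] keeps track of the unused part of the geometric tail,
   which is what makes the induction on [m] go through. *)
have tail n m :
    (1 - k) * mdist (u n) (u (n + m)%N) + C * k ^+ (n + m) <= C * k ^+ n.
  elim: m => [|m IHm]; first by rewrite addn0 mdistxx mulr0 add0r.
  apply: le_trans IHm; rewrite addnS exprS.
  have tri : (1 - k) * mdist (u n) (u (n + m).+1) <=
      (1 - k) * (mdist (u n) (u (n + m)%N) + C * k ^+ (n + m)).
    apply: ler_wpM2l; first by rewrite subr_ge0 ltW.
    by rewrite (le_trans (metric_triangle _ (u (n + m)%N) _))// lerD2l uC.
  lra.
apply: cauchy_exP => e e0.
have : (geometric C k @ \oo --> (0 : R))%classic.
  by apply: cvg_geometric; rewrite ger0_norm.
move=> /cvgrPdist_lt /(_ ((1 - k) * e)).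
rewrite mulr_gt0 ?subr_gt0// => /(_ isT) [N _ /(_ N (leqnn N))].
rewrite /= sub0r normrN ger0_norm ?mulr_ge0 ?exprn_ge0// => small.
exists (u N), N => // n /= Nn; rewrite ballEmdist /=.
rewrite -(ltr_pM2l (_ : 0 < 1 - k)) ?subr_gt0//.
apply: le_lt_trans small; apply: le_trans (tail N (n - N)%N).
by rewrite subnKC// lerDl mulr_ge0 ?exprn_ge0.
Qed.

Definition coupled_map (X : Type) (F : X * X -> X) (p : X * X) : X * X :=
  (F p, F (p.2, p.1)).

Definition displacement (R : realType) (X : metricType R) (F : X * X -> X)
    (p : X * X) : R :=
  mdist p.1 (F p) + mdist p.2 (F (p.2, p.1)).

Definition coupled_le (disp : Order.disp_t) (X : porderType disp)
    (p q : X * X) : bool :=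
  (p.1 <= q.1)%O && (q.2 <= p.2)%O.

Lemma displacement_ge0 (R : realType) (X : metricType R) (F : X * X -> X) p :
  0 <= displacement F p.
Proof. by rewrite addr_ge0 ?mdist_ge0. Qed.

Lemma coupled_map_homo (disp : Order.disp_t) (X : porderType disp)
    (F : X * X -> X) : mixed_monotone F ->
  {homo coupled_map F : p q / coupled_le p q}.
Proof.
move=> Fmono [x y] [u v] /andP[/= xu vy]; rewrite /coupled_le /=.
apply/andP; split.
- exact: le_trans ((Fmono x y).2 _ _ vy) ((Fmono x v).1 _ _ xu).
- exact: le_trans ((Fmono v u).2 _ _ xu) ((Fmono v x).1 _ _ vy).
Qed.

(** Write [p = (u, v)] and [coupled_map F p = (x, y)]. Since [x = F (u, v)] and
    [y = F (v, u)], the numerator [2 + d (u, F (u, v)) + d (v, F (v, u))] in the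
    first argument of the minimum equals the denominator
    [2 + d (x, u) + d (y, v)], which leaves [d (x, F (x, y))]. *)
Lemma contraction_M_later (R : realType) (X : metricType R) (F : X * X -> X)
    (p : X * X) :
  contraction_M F (coupled_map F p) p
    <= mdist (F p) (F (coupled_map F p)).
Proof.
case: p => x y; rewrite /coupled_map /=; rewrite ge_min; apply/orP; left.
rewrite (metric_sym x) (metric_sym y) divff ?mulr1//.
by rewrite gt_eqF// ltr_wpDr ?mdist_ge0// ltr_wpDr ?mdist_ge0.
Qed.

(** Mirror image of [contraction_M_later]: with the two pairs exchanged it is
    the second argument of the minimum that collapses. *)
Lemma contraction_M_earlier (R : realType) (X : metricType R) (F : X * X -> X)
    (p : X * X) :
  contraction_M F p (coupled_map F p)
    <= mdist (F p) (F (coupled_map F p)).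
Proof.
case: p => x y; rewrite /coupled_map /=; rewrite ge_min; apply/orP; right.
rewrite divff ?mulr1//.
by rewrite gt_eqF// ltr_wpDr ?mdist_ge0// ltr_wpDr ?mdist_ge0.
Qed.

(** For the first components the contractive inequality is applied to
    [coupled_map F p] and [p]; for the second components it is applied to the
    swapped pairs, whose order is reversed, so that [p] comes first. *)
Lemma displacement_coupled_map (R : realType) (disp : Order.disp_t)
    (X : porderCompleteMetricType R disp) (F : X * X -> X) (alpha beta : R)
    (p : X * X) :
  0 < alpha -> alpha < 1 ->
  (forall x y u v : X, (x >= u)%O -> (y <= v)%O ->
    mdist (F (x, y)) (F (u, v)) <=
      alpha * contraction_M F (x, y) (u, v)
      + beta / 2 * (mdist x u + mdist y v)) ->
  coupled_le p (coupled_map F p) ->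
  displacement F (coupled_map F p) <= beta / (1 - alpha) * displacement F p.
Proof.
case: p => x y a0 a1 Fcontr /andP[/= xF Fy].
have := Fcontr _ _ _ _ xF Fy; have := Fcontr _ _ _ _ Fy xF.
have := ler_wpM2l (ltW a0) (contraction_M_later F (x, y)).
have := ler_wpM2l (ltW a0) (contraction_M_earlier F (y, x)).
rewrite /displacement /coupled_map; move: (contraction_M F) => M /=.
move=> My Mx Cy Cx.
rewrite mulrAC ler_pdivlMr ?subr_gt0//.
rewrite (metric_sym (F (F (x, y), F (y, x)))) in Cx.
rewrite (metric_sym (F (x, y)) x) (metric_sym (F (y, x)) y) in Cx.
lra.
Qed.

Theorem theorem1 (R : realType) (disp : Order.disp_t)
    (X : porderCompleteMetricType R disp) (F : X * X -> X)
    (F_continuous : continuous F)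
    (F_mixed_monotone : mixed_monotone F)
    (F_contraction : exists alpha beta : R,
      [/\ 0 < alpha, 0 < beta, alpha + beta < 1 &
        forall x y u v : X, (x >= u)%O -> (y <= v)%O ->
          mdist (F (x, y)) (F (u, v)) <=
            alpha * contraction_M F (x, y) (u, v)
            + beta / 2 * (mdist x u + mdist y v)])
    (F_start : exists x0 y0 : X,
      (x0 <= F (x0, y0))%O /\ (y0 >= F (y0, x0))%O) :
  exists p : X * X, coupled_fixed_point F p.
Proof.
case: F_contraction => alpha [beta [a0 b0 ab1 Fcontr]].
case: F_start => x0 [y0 [x0F Fy0]].
pose z n := iter n (coupled_map F) (x0, y0).
have zS n : z n.+1 = coupled_map F (z n) by [].
have z_incr n : coupled_le (z n) (z n.+1).
  elim: n => [|n IHn]; first exact/andP.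
  by rewrite !zS; exact: coupled_map_homo.
set k := beta / (1 - alpha).
have a1 : alpha < 1 by lra.
have k0 : 0 <= k by rewrite divr_ge0 ?subr_ge0 ?ltW.
have k1 : k < 1 by rewrite ltr_pdivrMr ?subr_gt0// mul1r; lra.
have z_steps n : displacement F (z n) <= displacement F (z 0%N) * k ^+ n.
  elim: n => [|n IHn]; first by rewrite expr0 mulr1.
  apply: le_trans (displacement_coupled_map a0 a1 Fcontr (z_incr n)) _.
  by rewrite exprS mulrCA ler_wpM2l.
have C0 := displacement_ge0 F (z 0%N).
have /cauchy_cvg/cvg_ex[x zx] : cauchy ((fun n => (z n).1) @ \oo)%classic.
  apply: (cauchy_geometric_steps C0 k0 k1) => n.
  by apply: le_trans (z_steps n); rewrite lerDl mdist_ge0.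
have /cauchy_cvg/cvg_ex[y zy] : cauchy ((fun n => (z n).2) @ \oo)%classic.
  apply: (cauchy_geometric_steps C0 k0 k1) => n.
  by apply: le_trans (z_steps n); rewrite lerDr mdist_ge0.
have F_lim (u v : nat -> X) a b : (u @ \oo --> a)%classic ->
    (v @ \oo --> b)%classic -> (forall n, u n.+1 = F (u n, v n)) -> F (a, b) = a.
  move=> ua vb uS.
  have Fuv : ((fun n => F (u n, v n)) @ \oo --> F (a, b))%classic.
    apply: (cvg_comp _ F (cvg_pair ua vb)); exact: F_continuous (a, b).
  have uSa : ((fun n => F (u n, v n)) @ \oo --> a)%classic.
    by move: ua; rewrite -cvg_shiftS (funext uS).
  exact: (@cvg_unique _ (@metric_hausdorff R X) _ _ _ _ Fuv uSa).
exists (x, y); split => /=; first apply: F_lim zx zy _ => n.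
  by rewrite zS; case: (z n).
exact: F_lim zy zx _.
Qed.
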